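(* Let $X$ be a Banach space (over $\mathbb K\in\{\mathbb R,\mathbb C\}$) with a $1$-unconditional Schauder basis. Then $(B_X,w)$, the closed unit ball of $X$ with its relative weak topology, has a countable $\pi$-base.
   Context: $1$-unconditional basis: a Schauder basis $(e_j)_{j=1}^\infty$ of $X$ such that for every $N\in\mathbb N$ and all scalars $a_1,\dots,a_N,b_1,\dots,b_N$ with $|a_j|\le|b_j|$ for all $j$, one has $\left\|\sum_{j=1}^N a_je_j\right\|\le \left\|\sum_{j=1}^N b_je_j\right\|$. A $\pi$-base for a topological space $(T,\tau)$ is a family $\mathcal U$ of nonempty open subsets of $T$ such that every nonempty open subset of $T$ contains some member of $\mathcal U$; the space has a countable $\pi$-base if $\mathcal U$ can be chosen countable. *)

(* Defs.v *)
From mathcomp Require Import all_boot all_order all_algebra.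
From mathcomp Require Import all_classical all_reals all_analysis.

Set Implicit Arguments.
Unset Strict Implicit.
Unset Printing Implicit Defensive.

Import Order.TTheory GRing.Theory Num.Theory.
Import numFieldNormedType.Exports.

Local Open Scope classical_set_scope.
Local Open Scope ring_scope.

Definition pi_base (T : topologicalType) (U : set (set T)) : Prop :=
  (forall V, U V -> open V /\ V !=set0) /\
  (forall O : set T, open O -> O !=set0 -> exists2 V, U V & V `<=` O).

Definition has_countable_pi_base (T : topologicalType) : Prop :=
  exists2 U : set (set T), countable U & pi_base U.

(* Bases are indexed from 0; [series u n] is the sum of [u k] over [k < n]. *)
Definition schauder_basis (K : numFieldType) (X : normedModType K)
    (e : nat -> X) : Prop :=
  forall x : X, exists! a : nat -> K,
    series (fun j => a j *: e j) @ \oo --> x.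

Definition one_unconditional (K : numFieldType) (X : normedModType K)
    (e : nat -> X) : Prop :=
  forall (N : nat) (a b : nat -> K),
    (forall j, (j < N)%N -> `|a j| <= `|b j|) ->
    `|\sum_(j < N) a j *: e j| <= `|\sum_(j < N) b j *: e j|.

Definition one_unconditional_basis (K : numFieldType) (X : normedModType K)
    (e : nat -> X) : Prop :=
  schauder_basis e /\ one_unconditional e.

Definition topological_dual (K : numFieldType) (X : normedModType K) : Type :=
  {f : {linear X -> K^o} | continuous f}.

(* The vector space X with sigma(X, X^* ): a copy of X carrying the coarsest
   topology that makes all elements of the topological dual continuous. *)
Definition weak_space (K : numFieldType) (X : normedModType K) :
    topologicalType :=
  @sup_topology X (topological_dual X)
    (fun f => Topological.class (initial_topology (projT1 f))).

Definition closed_unit_ball (K : numFieldType) (X : normedModType K) : set X :=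
  [set x | `|x| <= 1].
Arguments closed_unit_ball {K} X.

(* [set_type A] carries the relative topology of [A]. *)
Definition weak_unit_ball (K : numFieldType) (X : normedModType K) :
    topologicalType :=
  set_type (closed_unit_ball X : set (weak_space X)).

(* Main.v *)
From HB Require Import structures.
Require Import Defs.
From mathcomp Require Import all_boot all_order all_algebra.
From mathcomp Require Import all_classical all_reals all_analysis.
From mathcomp Require Import complex ring lra.

(* The sets of points of the ball with finitely many coordinates prescribed up
   to a tolerance are a countable pi-base. Given functionals [f_i],
   put w_j = sum_i |f_i(e_j)|; by 1-unconditionality the weight
   Phi(x) = sum_j w_j |x_j| is bounded on the ball. If no coordinate box around
   a finitely supported x stays in the slice [|f_i - c_i| < 2d], a pigeonhole
   argument gives y and y' in the ball, outside the slice, with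
   f_i(y) close to f_i(y'), y close to x on the support of x, and y' close to
   x on the support of y. Negating the tail of y (still in the ball, by
   1-unconditionality) and averaging with y' gives a point whose f_i-values
   are close to those of x, but whose weight is larger by at least d/4. This
   can be repeated only finitely often. *)

Set Implicit Arguments.
Unset Strict Implicit.
Unset Printing Implicit Defensive.

Import Order.TTheory GRing.Theory Num.Theory.
Import numFieldNormedType.Exports.
Local Open Scope classical_set_scope.
Local Open Scope ring_scope.

(** * Archimedean scalars and finite nets *)

Definition archimedean_scalars (K : numFieldType) : Prop :=
  forall x : K, exists n, `|x| < n%:R.

(** Total boundedness of bounded sets of scalars, isolated so that one argument serves both the real
    and the complex case. *)
Definition finite_nets (K : numFieldType) : Prop :=
  forall M eps : K, 0 < eps ->
  exists s : seq K, forall x, `|x| <= M -> exists2 q, q \in s & `|x - q| < eps.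

(** If every [t] failed at some [g t], then by monotonicity all of them would fail at the maximum of
    [g]. *)
Lemma pigeonhole_monotone (T : finType) (P : nat -> T -> Prop) :
  (forall m n t, (m <= n)%N -> P n t -> P m t) ->
  (forall n, exists t, P n t) -> exists t, forall n, P n t.
Proof.
move=> mono ex; apply: contrapT => /forallNP noP.
have {noP} /choice [g gP] : forall t, exists n, ~ P n t.
  by move=> t; apply/existsNP.
have [t] := ex (\max_t g t).
by move=> /(mono (g t)) Pt; apply: (gP t); apply: Pt; exact: leq_bigmax.
Qed.

Lemma exists_small (K : numFieldType) : archimedean_scalars K ->
  forall (A x : K) m, 0 <= A -> 0 < x ->
  exists2 n, (m <= n)%N & A * n.+1%:R^-1 <= x.
Proof.
move=> arch A x m A0 x0; have [n An] := arch (A / x).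
exists (maxn m n); first exact: leq_maxl.
rewrite ler_pdivrMr ?ltr0n// mulrC -ler_pdivrMr//.
apply: le_trans (_ : `|A / x| <= _); first by rewrite ger0_norm ?divr_ge0// ltW.
by rewrite (le_trans (ltW An))// ler_nat ltnW// ltnS leq_maxr.
Qed.

Lemma exists_below (K : numFieldType) (I : finType) (g : I -> K) :
  archimedean_scalars K -> (forall i, 0 < g i) ->
  exists2 s, 0 < s & forall i, s <= g i.
Proof.
move=> arch g0.
have /choice [n nP] : forall i, exists n, 1 * n.+1%:R^-1 <= g i.
  by move=> i; have [n _] := exists_small arch 0 ler01 (g0 i); exists n.
exists (\max_i n i).+1%:R^-1 => [|i]; first by rewrite invr_gt0 ltr0n.
rewrite (le_trans _ (nP i))// mul1r lef_pV2 ?posrE ?ltr0n// ler_nat ltnS.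
exact: leq_bigmax.
Qed.

(** * Finite combinations of a 1-unconditional sequence *)

Section LinearCombinations.
Context {K : numFieldType} {X : normedModType K} (e : nat -> X).
Implicit Types (a b : nat -> K) (N L : nat).

Definition lincomb a N : X := \sum_(j < N) a j *: e j.

Definition cutoff N a : nat -> K := fun j => if (j < N)%N then a j else 0.

Lemma lincomb_eq N a b : (forall j, (j < N)%N -> a j = b j) ->
  lincomb a N = lincomb b N.
Proof. by move=> ab; apply: eq_bigr => j _; rewrite ab. Qed.

Lemma lincomb_linear k l a b N :
  lincomb (fun j => k * a j + l * b j) N = k *: lincomb a N + l *: lincomb b N.
Proof.
rewrite !scaler_sumr -big_split/=; apply: eq_bigr => j _.
by rewrite scalerDl !scalerA.
Qed.

Lemma lincombB a b N :
  lincomb (fun j => a j - b j) N = lincomb a N - lincomb b N.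
Proof.
rewrite -[lincomb a N]scale1r -scaleN1r -lincomb_linear.
by apply: lincomb_eq => j _; rewrite mul1r mulN1r.
Qed.

Lemma lincomb_cutoff N L a : (N <= L)%N -> lincomb (cutoff N a) L = lincomb a N.
Proof.
move=> NL; rewrite /lincomb (big_ord_widen L (fun j => a j *: e j))//.
rewrite [RHS]big_mkcond/=; apply: eq_bigr => j _.
by rewrite /cutoff; case: ifP => // _; rewrite scale0r.
Qed.

Hypothesis unc : one_unconditional e.

Lemma norm_lincomb_mono N L a : (N <= L)%N ->
  `|lincomb a N| <= `|lincomb a L|.
Proof.
move=> NL; rewrite -(lincomb_cutoff _ NL); apply: unc => j jL.
by rewrite /cutoff; case: ifP; rewrite ?normr0.
Qed.

Lemma norm_coefficient_le N a j : (j < N)%N ->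
  `|a j| * `|e j| <= `|lincomb a N|.
Proof.
move=> jN; rewrite -normrZ.
rewrite (_ : a j *: e j = lincomb (fun k => if k == j then a k else 0) N).
  by apply: unc => k kN; case: ifP; rewrite ?normr0.
rewrite /lincomb (bigD1 (Ordinal jN))//= eqxx big1 ?addr0// => k.
by rewrite -val_eqE/= => /negbTE ->; rewrite scale0r.
Qed.

(** Multiplying each [a j] by a scalar of modulus at most 1 does not increase the norm; phases that
    make every [a j * f (e j)] nonnegative turn the sum into a single value of [f]. *)
Lemma functional_abs_le (f : {linear X -> K^o}) (C : K) a N : 0 <= C ->
  (forall x, `|f x| <= C * `|x|) ->
  \sum_(j < N) `|f (e j)| * `|a j| <= C * `|lincomb a N|.
Proof.
move=> C0 fC.
(* Division by zero gives 0, so the phase is 0 where the product vanishes and its modulus never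
   exceeds 1. *)
pose s j : K := `|a j * f (e j)| / (a j * f (e j)).
have le1 : `|lincomb (fun j => s j * a j) N| <= `|lincomb a N|.
  apply: unc => j _; rewrite normrM ler_piMl// /s normrM normfV normr_id.
  by have [->|?] := eqVneq `|a j * f (e j)| 0; rewrite ?mul0r// divff.
have : \sum_(j < N) `|f (e j)| * `|a j| = f (lincomb (fun j => s j * a j) N).
  rewrite linear_sum; apply: eq_bigr => j _.
  rewrite linearZ/= /GRing.scale/= -mulrA /s.
  have [z|nz] := eqVneq (a j * f (e j)) 0; last by rewrite divfK// normrM mulrC.
  by rewrite mulrC -normrM z mulr0 normr0.
move=> sumE; rewrite -[leLHS]ger0_norm; last first.
  by apply: sumr_ge0 => j _; rewrite mulr_ge0.
by rewrite sumE (le_trans (fC _))// ler_wpM2l.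
Qed.

(** * The weight Phi ([weighted]) and how it increases *)

Section Weights.
Context {I : finType} (f : I -> {linear X -> K^o}).

Definition weight j : K := \sum_i `|f i (e j)|.

Definition weighted a N : K := \sum_(j < N) weight j * `|a j|.

Lemma weight_ge0 j : 0 <= weight j.
Proof. by apply: sumr_ge0. Qed.

Lemma weighted_ge0 a N : 0 <= weighted a N.
Proof. by apply: sumr_ge0 => j _; rewrite mulr_ge0 ?weight_ge0. Qed.

Lemma weighted_mono N L a : (N <= L)%N -> weighted a N <= weighted a L.
Proof.
move=> NL; rewrite /weighted -!(big_mkord xpredT (fun j => weight j * `|a j|)).
rewrite [leRHS](big_cat_nat _ NL)//= lerDl.
by apply: sumr_ge0 => j _; rewrite mulr_ge0 ?weight_ge0.
Qed.

Lemma weighted_eq N a b : (forall j, (j < N)%N -> a j = b j) ->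
  weighted a N = weighted b N.
Proof. by move=> ab; apply: eq_bigr => j _; rewrite ab. Qed.

Lemma weighted_cutoff N L a : (N <= L)%N ->
  weighted (cutoff N a) L = weighted a N.
Proof.
move=> NL; rewrite /weighted (big_ord_widen L (fun j => weight j * `|a j|))//.
rewrite [RHS]big_mkcond/=; apply: eq_bigr => j _.
by rewrite /cutoff; case: ifP => // _; rewrite normr0 mulr0.
Qed.

Lemma functional_le_weighted i a N : `|f i (lincomb a N)| <= weighted a N.
Proof.
rewrite linear_sum (le_trans (ler_norm_sum _ _ _))//; apply: ler_sum => j _.
rewrite linearZ/= normrM mulrC ler_wpM2r// /weight.
by rewrite (bigD1 i)//= lerDl sumr_ge0.
Qed.

Lemma weighted_le_tolerance a N (r : K) :
  (forall j, (j < N)%N -> `|a j| <= r) ->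
  weighted a N <= (\sum_(j < N) weight j) * r.
Proof.
move=> ar; rewrite mulr_suml; apply: ler_sum => j _.
by rewrite ler_wpM2l ?weight_ge0// ar.
Qed.

(** After exchanging the sums, each functional contributes at most [C]. This bound is what ends the
    ascent. *)
Lemma weighted_bounded (C : K) a N : 0 <= C ->
  (forall i x, `|f i x| <= C * `|x|) -> `|lincomb a N| <= 1 ->
  weighted a N <= #|I|%:R * C.
Proof.
move=> C0 fC a1.
rewrite /weighted (eq_bigr (fun j : 'I_N => \sum_i `|f i (e j)| * `|a j|)).
  rewrite exchange_big/= (le_trans (ler_sum (G := fun=> C) _ _))// => [i _|].
    by rewrite (le_trans (functional_abs_le _ _ C0 (fC i)))// ler_piMr.
  by rewrite sumr_const mulr_natl.
by move=> j _; rewrite mulr_suml.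
Qed.

Lemma weightedZ k a N : weighted (fun j => k * a j) N = `|k| * weighted a N.
Proof.
by rewrite mulr_sumr; apply: eq_bigr => j _; rewrite normrM mulrCA.
Qed.

(* The flip of [b] beyond [N] averaged with [b'] changes no [f i] by much, but
   collects the weight that [b] carries beyond [N]. *)
Lemma weighted_flipD a b b' N L : (N <= L)%N ->
  weighted a N *+ 2 + weighted (fun j => if (j < N)%N then 0 else b j) L
  <= weighted (fun j => (if (j < N)%N then b j else - b j) + b' j) L
     + weighted (fun j => b j - a j) N
     + weighted (fun j => b' j - cutoff N a j) L.
Proof.
move=> NL; rewrite -(weighted_cutoff a NL).
rewrite -(weighted_cutoff (fun j => b j - a j) NL) mulr2n.
(* Term by term: below [N], [2 a j] differs from [b j + b' j] by the two error terms; from [N] on,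
   [a] is cut off, so [b' j] is itself the error between [b j] and [b j - b' j]. *)
rewrite /weighted -!big_split/=; apply: ler_sum => j _.
rewrite -!mulrDr ler_wpM2l ?weight_ge0// /cutoff; case: ifPn => jN.
  rewrite normr0 addr0 -mulr2n -normrMn -[leLHS]normrN.
  rewrite (_ : - (a j *+ 2) = - (b j + b' j) + (b j - a j) + (b' j - a j)); last by ring.
  rewrite (le_trans (ler_normD _ _))// lerD2r.
  by rewrite (le_trans (ler_normD _ _))// normrN.
rewrite normr0 !add0r addr0 subr0 -[X in `|X|](addrNK (b' j)).
by rewrite (le_trans (ler_normD _ _))// lerD2r distrC addrC.
Qed.

(** A witness that the box of level [n] around [lincomb a N] leaves the slices of radius [2d].
    Comparing with [cutoff N a] makes [b] almost vanish between [N] and [n]. *)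
Definition escapes (c : I -> K) (d : K) a N n b L : Prop :=
  [/\ (n <= L)%N, `|lincomb b L| <= 1,
     forall j, (j < n)%N -> `|b j - cutoff N a j| < n.+1%:R^-1 &
     exists i, d *+ 2 <= `|f i (lincomb b L) - c i|].

Lemma weighted_increase C (c : I -> K) (d : K) a N :
  0 <= C -> (forall i x, `|f i x| <= C * `|x|) -> 0 < d ->
  archimedean_scalars K -> finite_nets K ->
  `|lincomb a N| <= 1 -> (forall i, `|f i (lincomb a N) - c i| < d) ->
  (forall n, exists b L, escapes c d a N n b L) ->
  exists a' N', [/\ `|lincomb a' N'| <= 1,
    forall i, `|f i (lincomb a' N') - c i| < d &
    weighted a N + d / 4 <= weighted a' N'].
Proof.
move=> C0 fC d0 arch nets a1 ac stuck.
have W0 M : 0 <= \sum_(j < M) weight j by apply: sumr_ge0 => j _; exact: weight_ge0.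
(* The slack [s] obeys finitely many bounds, indexed by [option I]: [None] for [d / 2], [Some i] for
   the room left in the [i]-th slice. *)
have [s s0 sP] : exists2 s, 0 < s & s <= d / 2 /\
    forall i, `|f i (lincomb a N) - c i| + s <= d.
  pose g (o : option I) := if o is Some i then d - `|f i (lincomb a N) - c i| else d / 2.
  have [|s s0 sg] := @exists_below _ _ g arch.
    by move=> [i|]/=; rewrite ?subr_gt0 ?divr_gt0.
  exists s => //; split; first exact: (sg None).
  by move=> i; rewrite addrC -lerBrDr; exact: (sg (Some i)).
have s20 : 0 < s / 2 by rewrite divr_gt0.
have [net netP] := nets C _ s20.
(* Pigeonhole on the net points near the values [f i]: one tuple [t] serves at every level [n], so
   escaping points from different levels have nearly equal values. *)
have [t tP] : exists t : I -> K, forall n, exists b L,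
    escapes c d a N n b L /\ forall i, `|f i (lincomb b L) - t i| < s / 2.
  have [||t tP] := @pigeonhole_monotone {ffun I -> 'I_(size net)}
    (fun n t => exists b L, escapes c d a N n b L /\
      forall i, `|f i (lincomb b L) - net`_(t i)| < s / 2).
  - move=> m n t mn [b [L [[nL b1 ba bad] bt]]]; exists b, L; split => //.
    split => //; first exact: leq_trans nL.
    move=> j jm; apply: lt_le_trans (ba j (leq_trans jm mn)) _.
    by rewrite lef_pV2 ?posrE ?ltr0n// ler_nat ltnS.
  - move=> n; have [b [L besc]] := stuck n.
    have [_ b1 _ _] := besc.
    have /choice [t tP] : forall i, exists k : 'I_(size net),
        `|f i (lincomb b L) - net`_k| < s / 2.
      move=> i; have [|q qnet qP] := netP (f i (lincomb b L)).
        by rewrite (le_trans (fC _ _))// ler_piMr.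
      move: (qnet); rewrite -index_mem => qi; exists (Ordinal qi) => /=.
      by rewrite nth_index.
    by exists [ffun i => t i], b, L; split => // i; rewrite ffunE.
  - by exists (fun i => net`_(t i)).
have [n0 Nn0 n0P] := exists_small arch N (W0 N) s20.
have [b [L [[n0L b1 ba [i0 bad]] bt]]] := tP n0.
have NL := leq_trans Nn0 n0L.
(* The level of [b'] exceeds [L], so [b'] is close to [cutoff N a] on the whole support of [b]. *)
have [n1 Ln1 n1P] := exists_small arch L (W0 L) s20.
have [b' [L' [[n1L' b'1 b'a _] b't]]] := tP n1.
have LL' := leq_trans Ln1 n1L'.
have {ba} P_le : weighted (fun j => b j - a j) N <= s / 2.
  apply: le_trans n0P; apply: weighted_le_tolerance => j jN.
  by have := ba j (leq_trans jN Nn0); rewrite /cutoff jN => /ltW.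
have {b'a} Q_le : weighted (fun j => b' j - cutoff N a j) L <= s / 2.
  apply: le_trans n1P; apply: weighted_le_tolerance => j jL.
  exact: ltW (b'a j (leq_trans jL Ln1)).
have fbN i : `|f i (lincomb b N) - f i (lincomb a N)| <= s / 2.
  by rewrite -linearB -lincombB (le_trans _ P_le)// functional_le_weighted.
(* With [u] the flip of [b] beyond [N], the average [z] equals [b] truncated at [N] plus half of
   [b' - b]. The truncation costs at most [s / 2] in each [f i], the half difference less than
   [s / 2]. *)
pose u j := if (j < N)%N then b j else - b j.
pose z j := 2^-1 * cutoff L u j + 2^-1 * b' j.
have lcu : lincomb u L = 2 *: lincomb b N - lincomb b L.
  rewrite -(lincomb_cutoff b NL) -scaleN1r -lincomb_linear.
  apply: lincomb_eq => j _; rewrite /u /cutoff.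
  by case: ifP => _; ring.
have lcz : lincomb z L' = 2^-1 *: lincomb u L + 2^-1 *: lincomb b' L'.
  by rewrite -(lincomb_cutoff u LL') -lincomb_linear.
exists z, L'; split.
- have u1 : `|lincomb u L| <= 1.
    apply: le_trans b1; apply: unc => j _; rewrite /u.
    by case: ifP; rewrite ?normrN.
  rewrite lcz (le_trans (ler_normD _ _))// !normrZ ger0_norm ?invr_ge0//.
  by rewrite -mulrDr ler_pdivrMl// mulr1 lerD.
- move=> i.
  have -> : f i (lincomb z L') - c i = (f i (lincomb a N) - c i)
      + (f i (lincomb b N) - f i (lincomb a N))
      + (2^-1 * (f i (lincomb b' L') - t i) - 2^-1 * (f i (lincomb b L) - t i)).
    rewrite lcz lcu linearD !linearZ linearB linearZ/= /GRing.scale/=.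
    by field.
  apply: lt_le_trans (sP.2 i).
  rewrite (splitr s) [ltRHS]addrA.
  rewrite (le_lt_trans (ler_normD _ _))// ler_ltD//.
    by rewrite (le_trans (ler_normD _ _))// lerD2l.
  rewrite (le_lt_trans (ler_normB _ _))// !normrM ger0_norm ?invr_ge0//.
  by rewrite -mulrDr mulrC ltr_pdivrMr// mulr_natr mulr2n ltrD.
- apply: le_trans (weighted_mono _ LL').
  have -> : weighted z L = 2^-1 * weighted (fun j => u j + b' j) L.
    rewrite -[X in _ = X * _]ger0_norm ?invr_ge0// -weightedZ.
    by apply: weighted_eq => j jL; rewrite /z /cutoff jL mulrDr.
  (* Truncated at [N], [b] still has its [f i0] value within [d] of [c i0]; as the full value is at
     least [2d] away, the tail accounts for [d]. *)
  have t_ge : d <= weighted (fun j => if (j < N)%N then 0 else b j) L.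
    have -> : weighted (fun j => if (j < N)%N then 0 else b j) L =
              weighted (fun j => b j - cutoff N b j) L.
      by apply: weighted_eq => j _; rewrite /cutoff; case: ifP; rewrite ?subrr ?subr0.
    apply: le_trans (functional_le_weighted i0 _ _).
    rewrite lincombB (lincomb_cutoff _ NL) linearB -(lerD2r d) -mulr2n.
    apply: le_trans bad _.
    rewrite (_ : _ - c i0 = (f i0 (lincomb b L) - f i0 (lincomb b N))
      + ((f i0 (lincomb b N) - f i0 (lincomb a N)) + (f i0 (lincomb a N) - c i0))).
      rewrite (le_trans (ler_normD _ _))// lerD2l.
      rewrite (le_trans (ler_normD _ _))// addrC (le_trans _ (sP.2 i0))// lerD2l.
      by rewrite (le_trans (fbN i0))// ler_pdivrMr// ler_peMr ?ler1n// ltW.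
    by ring.
  (* Of the tail weight [d], the two errors consume at most [s <= d / 2]; halving the rest leaves
     the gain [d / 4]. *)
  have := weighted_flipD a b b' NL.
  rewrite ler_pdivlMl// => flipD; rewrite -(lerD2r (d / 2)).
  rewrite (_ : _ + d / 2 = weighted a N *+ 2 + d); last by field.
  apply: le_trans (_ : weighted a N *+ 2 + _ <= _); first by rewrite lerD2l; exact: t_ge.
  apply: le_trans flipD _; rewrite -addrA lerD2l.
  by apply: le_trans (lerD P_le Q_le) _; rewrite -splitr sP.1.
Qed.

End Weights.

End LinearCombinations.

(** Each failing centre is replaced by one with weight larger by [d / 4]; as the weight is bounded,
    [k] counts down to a centre that works. The new centre may be far from the old one, which a
    pi-base tolerates. *)
Lemma coordinate_box {K : numFieldType} {X : normedModType K} (e : nat -> X)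
    (I : finType) (f : I -> {linear X -> K^o}) C (c : I -> K) (d : K) a N :
  one_unconditional e ->
  0 <= C -> (forall i x, `|f i x| <= C * `|x|) -> 0 < d ->
  archimedean_scalars K -> finite_nets K ->
  `|lincomb e a N| <= 1 -> (forall i, `|f i (lincomb e a N) - c i| < d) ->
  exists a' N' n, `|lincomb e a' N'| <= 1 /\ forall b L,
    (n <= L)%N -> `|lincomb e b L| <= 1 ->
    (forall j, (j < n)%N -> `|b j - cutoff N' a' j| < n.+1%:R^-1) ->
    forall i, `|f i (lincomb e b L) - c i| < d *+ 2.
Proof.
move=> unc C0 fC d0 arch nets.
have [k kP] := arch (#|I|%:R * C / (d / 4)).
have {kP}: #|I|%:R * C < weighted e f a N + k%:R * (d / 4).
  have d40 : 0 < d / 4 by rewrite divr_gt0.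
  apply: lt_le_trans (_ : k%:R * (d / 4) <= _); last by rewrite lerDr weighted_ge0.
  rewrite -ltr_pdivrMr//; apply: le_lt_trans kP.
  by rewrite ger0_norm// divr_ge0 ?mulr_ge0// ltW.
elim: k a N => [|k IH] a N.
  rewrite mul0r addr0 => lt a1 _.
  by have := lt_le_trans lt (weighted_bounded unc C0 fC a1); rewrite ltxx.
move=> lt a1 ac; apply: contrapT => no.
have [|a' [N' [a'1 a'c le]]] := weighted_increase unc C0 fC d0 arch nets a1 ac.
  move=> n; apply: contrapT => nobad; apply: no.
  exists a, N, n; split => // b L nL b1 ba i.
  apply: contrapT => bad; apply: nobad; exists b, L; split => //; exists i.
  by rewrite real_leNgt ?normr_real ?rpredMn ?gtr0_real//; exact/negP.
apply: no; apply: IH a'1 a'c; apply: lt_le_trans lt _.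
by rewrite -natr1 mulrDl mul1r addrCA addrC lerD2r.
Qed.

Lemma dense_of_finite_nets (K : numFieldType) :
  archimedean_scalars K -> finite_nets K ->
  exists D : nat * nat * nat -> K,
    forall x eps, 0 < eps -> exists i, `|x - D i| < eps.
Proof.
move=> arch nets.
have /choice [s sP] : forall p : nat * nat, exists s : seq K, forall x,
    `|x| <= p.1%:R -> exists2 q, q \in s & `|x - q| < p.2.+1%:R^-1.
  by move=> p; apply: nets; rewrite invr_gt0.
(* A triple encodes radius, mesh and position in the net; positions past its end read as 0,
   harmlessly. *)
exists (fun p => (s p.1)`_p.2) => x eps eps0.
have [m xm] := arch x.
have [n _ neps] := exists_small arch 0 ler01 eps0.
have [q qs xq] := sP (m, n) x (ltW xm).
exists (m, n, index q (s (m, n))) => /=; rewrite nth_index//.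
by apply: lt_le_trans xq _; rewrite -[leLHS]mul1r.
Qed.

(** * Neighbourhoods in the weak topology *)

Lemma weak_ball_nbhs (K : numFieldType) (X : normedModType K)
    (O : set (weak_unit_ball X)) (x0 : weak_unit_ball X) :
  open O -> O x0 ->
  exists (I : finType) (f : I -> topological_dual X) (d : I -> K),
    (forall i, 0 < d i) /\ forall y : weak_unit_ball X,
      (forall i, `|projT1 (f i) (set_val y) - projT1 (f i) (set_val x0)| < d i) -> O y.
Proof.
(* [F x] is the filter generated by the slices around [x]. It contains the neighbourhoods of [x] for
   each initial topology, hence converges weakly to [x]. *)
pose F (x : X) : set_system X := fun A => exists (I : finType)
    (f : I -> topological_dual X) (d : I -> K), (forall i, 0 < d i) /\
    forall y, (forall i, `|projT1 (f i) y - projT1 (f i) x| < d i) -> A y.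
have FF x : Filter (F x).
  split.
  - by exists void, (of_void _), (of_void _); split => // -[].
  - move=> P Q [I1 [f1 [d1 [d10 h1]]]] [I2 [f2 [d2 [d20 h2]]]].
    exists (I1 + I2)%type, (fun i => match i with inl i => f1 i | inr i => f2 i end),
      (fun i => match i with inl i => d1 i | inr i => d2 i end); split.
      by move=> [].
    by move=> y yP; split; [apply: h1 => i; exact: (yP (inl i))|
                            apply: h2 => i; exact: (yP (inr i))].
  - move=> P Q PQ [I1 [f1 [d1 [d10 h1]]]]; exists I1, f1, d1; split => // y /h1.
    exact: PQ.
have Fcvg x : F x --> (x : weak_space X).
  apply/cvg_sup => g A /=; rewrite (@nbhsE (initial_topology (projT1 g))).
  move=> -[B [[U oU <-] Ux] BA].
  have /nbhs_ballP[r r0 rU] : nbhs (projT1 g x) U by apply: open_nbhs_nbhs.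
  exists unit, (fun=> g), (fun=> r); split => // y yx; apply: BA; apply: rU.
  by rewrite -ball_normE /= distrC; exact: (yx tt).
move=> [W oW <-] Wx0.
have : F (set_val x0) W by apply: Fcvg; apply: open_nbhs_nbhs; split.
by move=> [I [f [d [d0 h]]]]; exists I, f, d; split => // y yP; apply: h.
Qed.

Lemma dual_weakly_continuous (K : numFieldType) (X : normedModType K)
  (g : topological_dual X) : continuous (projT1 g : weak_space X -> K^o).
Proof.
move=> x A; rewrite nbhsE => -[U [oU Ux] UA].
have /cvg_sup/(_ g) := (@cvg_id _ (nbhs (x : weak_space X))).
move=> /(_ (projT1 g @^-1` U)) cvgx.
have : nbhs (x : weak_space X) (projT1 g @^-1` U).
  apply: cvgx; apply: (@open_nbhs_nbhs (initial_topology (projT1 g))).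
  by split => //; exists U.
by apply: filterS => y; exact: UA.
Qed.

(** * Coordinate functionals of the basis *)

Section Coordinates.
Context {K : numFieldType} {X : normedModType K} (e : nat -> X).
Hypothesis basis : schauder_basis e.

Definition coordinate j x : K := projT1 (cid (basis x)) j.

Lemma series_lincomb (a : nat -> K) n :
  series (fun j => a j *: e j) n = lincomb e a n.
Proof. by rewrite /series/= big_mkord. Qed.

Lemma coordinate_cvg x :
  series (fun j => coordinate j x *: e j) @ \oo --> x.
Proof. by rewrite /coordinate; case: cid => a []. Qed.

Lemma coordinate_unique x (a : nat -> K) :
  series (fun j => a j *: e j) @ \oo --> x -> forall j, coordinate j x = a j.
Proof.
by rewrite /coordinate; case: cid => b [bx uniq] /= ax j; rewrite (uniq a).
Qed.

Lemma coordinate_linear j : linear (coordinate j : X -> K^o).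
Proof.
move=> k x y.
rewrite (@coordinate_unique (k *: x + y)
  (fun j => k * coordinate j x + coordinate j y))//.
rewrite (_ : series _ = (fun n => k *: series (fun j => coordinate j x *: e j) n
    + series (fun j => coordinate j y *: e j) n)).
  by apply: cvgD; [apply: cvgZr|]; exact: coordinate_cvg.
apply/funext => n; rewrite !series_lincomb -[X in _ = _ + X]scale1r -lincomb_linear.
by apply: lincomb_eq => i _; rewrite mul1r.
Qed.

HB.instance Definition _ j := GRing.isLinear.Build K X K^o *:%R (coordinate j)
  (coordinate_linear j).

Lemma coordinate_lincomb a N j : coordinate j (lincomb e a N) = cutoff N a j.
Proof.
apply: coordinate_unique; apply: cvg_near_cst.
near=> n; rewrite series_lincomb; apply: lincomb_cutoff.
by near: n; exact: nbhs_infty_ge.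
Unshelve. all: by end_near. Qed.

(** A vanishing [e j] would give the zero vector two expansions. *)
Lemma basis_neq0 j : e j != 0.
Proof.
apply/eqP => ej0.
have cvg0 (a : nat -> K) : (forall i, a i *: e i = 0) -> forall i, coordinate i 0 = a i.
  move=> a0; apply: coordinate_unique.
  apply: cvg_near_cst; apply: nearW => n.
  by rewrite series_lincomb /lincomb big1.
have c0 : coordinate j 0 = 0 by apply: (cvg0 (fun=> 0)) => i; rewrite scale0r.
have c1 : coordinate j 0 = (j == j)%:R.
  apply: (cvg0 (fun i => (i == j)%:R)) => i.
  by case: eqP => [->|_]; rewrite ?ej0 ?scaler0 ?scale0r.
by move: c1; rewrite c0 eqxx => /esym/eqP; rewrite oner_eq0.
Qed.

Lemma lincomb_coordinate_near x eps : 0 < eps ->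
  \forall n \near \oo, `|x - lincomb e (coordinate^~ x) n| < eps.
Proof.
move=> eps0; have /cvgrPdist_lt/(_ _ eps0) := @coordinate_cvg x.
by apply: filterS => n; rewrite series_lincomb.
Qed.

Hypothesis unc : one_unconditional e.

(** The norms of the partial sums increase to that of [x]. Hence truncations of points of the ball
    stay in the ball. *)
Lemma norm_lincomb_coordinate x n :
  `|lincomb e (coordinate^~ x) n| <= `|x|.
Proof.
apply/ler_addgt0Pr => eps eps0.
near \oo => L; apply: le_trans (norm_lincomb_mono unc _ (_ : n <= L)%N) _.
  by near: L; exact: nbhs_infty_ge.
rewrite -[X in `|X|](subrK x) addrC (le_trans (ler_normD _ _))// lerD2l distrC.
by apply: ltW; near: L; exact: lincomb_coordinate_near.
Unshelve. all: by end_near. Qed.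

(** A single term of the expansion has norm at most that of [x], so [|e j|^-1] bounds the
    functional. This makes coordinate boxes weakly open. *)
Lemma coordinate_continuous j : continuous (coordinate j : X -> K^o).
Proof.
apply: bounded_linear_continuous; apply/linear_boundedP.
near=> r => x.
have ej : 0 < `|e j| by rewrite normr_gt0 basis_neq0.
have : `|coordinate j x| <= `|e j|^-1 * `|x|.
  rewrite ler_pdivlMl// mulrC.
  apply: le_trans (norm_lincomb_coordinate x j.+1).
  exact: (norm_coefficient_le unc (coordinate^~ x)).
move=> /le_trans; apply; rewrite ler_wpM2r//.
Unshelve. all: by end_near. Qed.

Definition coordinate_functional j : topological_dual X :=
  exist _ (coordinate j : {linear X -> K^o}) (@coordinate_continuous j).

End Coordinates.

(** * The countable pi-base of boxes *)

Lemma dual_family_bounded (K : numFieldType) (X : normedModType K)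
    (I : finType) (f : I -> topological_dual X) :
  exists2 C, 0 < C & forall i x, `|projT1 (f i) x| <= C * `|x|.
Proof.
apply/pinfty_ex_gt0; apply: (@filter_forall _ _ _ (pinfty_nbhs K)) => i.
apply/linear_boundedP/continuous_linear_bounded; exact: (projT2 (f i)).
Qed.

Lemma norm_weak_unit_ball (K : numFieldType) (X : normedModType K)
  (y : weak_unit_ball X) : `|set_val y : X| <= 1.
Proof. by case: y => y yB; exact: set_mem yB. Qed.

Lemma countable_pi_base_weak_unit_ball (K : numFieldType)
    (X : normedModType K) (e : nat -> X) :
  archimedean_scalars K -> finite_nets K -> one_unconditional_basis e ->
  has_countable_pi_base (weak_unit_ball X).
Proof.
move=> arch nets [basis unc].
have [D dense] := dense_of_finite_nets arch nets.
(* A box is coded by its number of coordinates and a list of indices into [D], padded by a default.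
   Half of the tolerance is reserved for approximating the true centre by values of [D]. *)
pose box (p : nat * seq (nat * nat * nat)) : set (weak_unit_ball X) :=
  [set y | forall j : 'I_p.1,
    `|coordinate basis j (set_val y) - D (nth (0, 0, 0)%N p.2 j)| < p.1.+1%:R^-1 / 2].
have box_open p : open (box p).
  exists [set y : weak_space X | forall j : 'I_p.1,
    `|coordinate basis j y - D (nth (0, 0, 0)%N p.2 j)| < p.1.+1%:R^-1 / 2] => //.
  rewrite openE => x xp.
  apply: (@filter_forall _ _ _ (nbhs (x : weak_space X)) _) => j.
  set B := ball (D (nth (0, 0, 0)%N p.2 j) : K^o) (p.1.+1%:R^-1 / 2).
  have : nbhs (x : weak_space X) (coordinate basis j @^-1` B).
    apply: (@dual_weakly_continuous _ _ (coordinate_functional basis unc j) x).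
    apply: open_nbhs_nbhs; split; first by apply: ball_open; rewrite divr_gt0 ?invr_gt0.
    by rewrite /B -ball_normE /= distrC; exact: xp.
  by apply: filterS => y; rewrite /B -ball_normE /= distrC.
(* Members of a pi-base are nonempty, so empty boxes are discarded. *)
exists (range box `&` [set V | V !=set0]).
  apply: (@sub_countable _ _ _ (range box)).
    by apply: subset_card_le; exact: subIsetl.
  exact: sub_countable (card_image_le box setT) (countableP _).
split=> [V [[p _ <-] V0]|O oO [x0 Ox0]]; first by split.
have [I [f [d [d0 fO]]]] := weak_ball_nbhs oO Ox0.
have [r r0 rd] := exists_below arch d0.
have [C C0 fC] := dual_family_bounded f.
have x01 : `|set_val x0 : X| <= 1 by apply: norm_weak_unit_ball.
(* [coordinate_box] with [d = r / 3] keeps finite combinations within [2r / 3] of the values at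
   [x0]; the last third pays for truncating [y]. *)
have r30 : 0 < r / 3 by rewrite divr_gt0.
have [N xN] : exists N,
    `|set_val x0 - lincomb e (coordinate basis ^~ (set_val x0)) N| < r / 3 / C.
  near \oo => N; exists N; near: N.
  by apply: lincomb_coordinate_near; rewrite divr_gt0.
have [||a [M [n [aM1 inbox]]]] := @coordinate_box _ _ _ _ (fun i => projT1 (f i)) C
    (fun i => projT1 (f i) (set_val x0)) _ (coordinate basis ^~ (set_val x0)) N
    unc (ltW C0) fC r30 arch nets.
- exact: le_trans (norm_lincomb_coordinate _ unc _ _) x01.
- move=> i; rewrite -linearB (le_lt_trans (fC _ _))// distrC.
  by rewrite mulrC -ltr_pdivlMr.
have /choice [q qP] : forall j, exists k, `|cutoff M a j - D k| < n.+1%:R^-1 / 2.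
  by move=> j; apply: dense; rewrite divr_gt0 ?invr_gt0.
pose s := mkseq q n.
have nth_s j : (j < n)%N -> nth (0, 0, 0)%N s j = q j by exact: nth_mkseq.
exists (box (n, s)).
  split; first by exists (n, s).
  exists (exist _ (lincomb e a M) (mem_set aM1) : weak_unit_ball X) => j /=.
  by rewrite coordinate_lincomb nth_s.
move=> y yb; apply: fO => i.
have y1 : `|set_val y : X| <= 1 by apply: norm_weak_unit_ball.
apply: lt_le_trans (rd i).
(* [inbox] concerns finite combinations only, so [y] is replaced by a long truncation, whose
   coefficients are those of [y]. *)
pose yL := lincomb e (coordinate basis ^~ (set_val y)).
near \oo => L.
rewrite -(subrK (projT1 (f i) (yL L)) (projT1 (f i) (set_val y))) -addrA.
rewrite (_ : r = r / 3 + (r / 3) *+ 2); last by field.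
rewrite (le_lt_trans (ler_normD _ _))// ltrD//.
  rewrite -linearB (le_lt_trans (fC _ _))// mulrC -ltr_pdivlMr//.
  near: L; apply: lincomb_coordinate_near; by rewrite divr_gt0.
apply: inbox.
- by near: L; exact: nbhs_infty_ge.
- exact: le_trans (norm_lincomb_coordinate _ unc _ _) y1.
- move=> j jn; have := yb (Ordinal jn); rewrite /= nth_s// => yj.
  rewrite -(subrK (D (q j)) (coordinate _ _ _)) -addrA (splitr n.+1%:R^-1).
  by rewrite (le_lt_trans (ler_normD _ _))// ltrD// distrC.
Unshelve. all: by end_near. Qed.

(** * Real and complex scalars *)

Lemma archimedean_scalars_real (R : realType) : archimedean_scalars R.
Proof. by move=> x; exists (Num.bound `|x|); exact: archi_boundP. Qed.

Lemma finite_nets_real (R : realType) : finite_nets R.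
Proof.
move=> M eps eps0.
(* A grid of step [eps] starting at [-M]; rounding [(x + M) / eps] down picks the last grid point
   not beyond [x]. *)
exists [seq eps * k%:R - M | k <- iota 0 (Num.truncn ((M + M) / eps)).+1] => x.
rewrite ler_norml => /andP[Mx xM].
have xM0 : 0 <= (x + M) / eps by rewrite divr_ge0 ?(ltW eps0)//; lra.
exists (eps * (Num.truncn ((x + M) / eps))%:R - M).
  apply/mapP; exists (Num.truncn ((x + M) / eps)) => //.
  rewrite mem_iota/= add0n ltnS; apply: le_truncn.
  by rewrite ler_pM2r ?invr_gt0// lerD2r.
have /andP[] := truncn_itv xM0.
rewrite ler_pdivlMr// ltr_pdivrMr// -natr1 => lo hi.
by rewrite ltr_norml; apply/andP; split; lra.
Qed.

Lemma archimedean_scalars_complex (R : realType) : archimedean_scalars R[i]%C.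
Proof.
move=> x; have [n xn] := archimedean_scalars_real (complex.Re `|x|).
exists n; rewrite -[`|x|]RRe_real ?normr_real// -(rmorph_nat (real_complex R)).
by rewrite ltcR (le_lt_trans (ler_norm _)).
Qed.

Lemma norm_real_complex (R : realType) (r : R) :
  `|(r%:C)%C| = (`|r|%:C)%C.
Proof. by rewrite normc_def /= expr0n addr0 sqrtr_sqr. Qed.

(** The product of a real net with itself: errors below half of [eps] in the real and the imaginary
    part add up to less than [eps]. *)
Lemma finite_nets_complex (R : realType) : finite_nets R[i]%C.
Proof.
move=> M eps eps0.
have epsE : ((complex.Re eps)%:C)%C = eps by rewrite RRe_real ?gtr0_real.
have e20 : 0 < complex.Re eps / 2 by rewrite divr_gt0// -ltcR epsE.
have [s sP] := @finite_nets_real R (complex.Re M) _ e20.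
exists [seq (a +i* b)%C | a <- s, b <- s] => x xM.
have Re_le (y : R[i]%C) : `|y| <= M -> `|complex.Re y| <= complex.Re M.
  by move=> /(le_trans (normc_ge_Re y)); rewrite lecE => /andP[].
have [a sa xa] := sP _ (Re_le _ xM).
have [b sb xb] : exists2 b, b \in s & `|complex.Im x - b| < complex.Re eps / 2.
  (* Up to sign, the imaginary part of [x] is the real part of [x] times the imaginary unit, so
     [Re_le] applies again. *)
  apply: sP; rewrite -normrN -ReiNIm; apply: Re_le.
  by rewrite normrM normCi mulr1.
exists (a +i* b)%C; first exact: allpairs_f.
rewrite [x - _]complexE (le_lt_trans (ler_normD _ _))//.
rewrite normrM complexiE normCi mul1r !norm_real_complex -epsE.
rewrite -rmorphD ltcR (splitr (complex.Re eps)).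
by case: x xa xb {xM} => xr xi /= xa xb; rewrite ltrD.
Qed.

Theorem theorem5p1 (R : realType) :
  (forall X : completeNormedModType R,
     (exists e : nat -> X, one_unconditional_basis e) ->
     has_countable_pi_base (weak_unit_ball X)) /\
  (forall X : completeNormedModType R[i]%C,
     (exists e : nat -> X, one_unconditional_basis e) ->
     has_countable_pi_base (weak_unit_ball X)).
Proof.
split=> X [e]; apply: countable_pi_base_weak_unit_ball.
- exact: archimedean_scalars_real.
- exact: finite_nets_real.
- exact: archimedean_scalars_complex.
- exact: finite_nets_complex.
Qed.
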